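(* For $i=1,2$, let $f_i:\mathbb{R}^n\to\mathbb{R}\cup\{\infty\}$ be proper lsc functions whose subdifferentials are $(\mu_i,\rho_i)$-semimonotone with $\mu_i,\rho_i\in\mathbb{R}$ such that $\mu_1+\mu_2>0$ or $\mu_1=\mu_2=0$. Denote their infimal convolution by $$\varphi:s\mapsto\min_{w\in\mathbb{R}^n}\{f_1(w)+f_2(s-w)\}.$$ Suppose that for each $r_1\ge0$ and $\bar s\in\mathbb{R}^n$ there exists $r_2>0$ such that the set $$\Big\{(w_1,w_2)\in\mathbb{R}^n\times\mathbb{R}^n\ \Big|\ f_1(w_1)+f_2(w_2)\le r_1,\ \|w_1+w_2-\bar s\|\le r_2\Big\}$$ is bounded. Then the following hold. (i) $\partial\varphi(\bar s)\subseteq(\partial f_1\Box\partial f_2)(\bar s)$ for all $\bar s\in\mathbb{R}^n$. (ii) $\partial\varphi$ is $(\mu_1\Box\mu_2,\rho_1+\rho_2)$-semimonotone.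
   Context: $\partial$ denotes the limiting subdifferential. An operator $A:\mathbb{R}^n\rightrightarrows\mathbb{R}^n$ is $(\mu,\rho)$-semimonotone if $\langle x-x',y-y'\rangle\ge\mu\|x-x'\|^2+\rho\|y-y'\|^2$ for all $(x,y),(x',y')$ with $y\in Ax$, $y'\in Ax'$. Parallel sum of operators: $A\Box B:=(A^{-1}+B^{-1})^{-1}$. Parallel sum of reals: $a\Box b=0$ if $a=b=0$, and $a\Box b=\frac{ab}{a+b}$ if $a+b\ne0$. *)

(* Defs.v *)
From HB Require Import structures.
From mathcomp Require Import all_boot all_order all_algebra.
From mathcomp Require Import all_classical all_reals all_analysis.
Import Order.TTheory GRing.Theory Num.Theory.
Import numFieldNormedType.Exports.

Set Implicit Arguments.
Unset Strict Implicit.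
Unset Printing Implicit Defensive.

Local Open Scope classical_set_scope.
Local Open Scope ring_scope.

(* R^n is 'rV[R]_n.  The library norm `|x| on it is the sup norm: it is used   *)
(* only through the topology and boundedness it induces; wherever a value of  *)
(* the norm matters, the Euclidean norm below is meant.                        *)
Definition dot (R : realType) (n : nat) (u v : 'rV[R]_n) : R :=
  \sum_(i < n) u 0 i * v 0 i.

Definition enorm (R : realType) (n : nat) (u : 'rV[R]_n) : R :=
  Num.sqrt (dot u u).

Definition proper_efun (R : realType) (n : nat) (f : 'rV[R]_n -> \bar R) : Prop :=
  (forall x, f x != -oo%E) /\ (exists x, f x != +oo%E).

(* f z >= f x + <v, z - x> + o(|z - x|) as z -> x, at points where f is finite *)
Definition regular_subdiff (R : realType) (n : nat) (f : 'rV[R]_n -> \bar R)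
    (x : 'rV[R]_n) : set 'rV[R]_n :=
  [set v | f x \is a fin_num /\
     forall e : R, 0 < e -> \forall z \near x,
       (f x + (dot v (z - x) - e * enorm (z - x))%:E <= f z)%E].

(* Limits of regular subgradients along sequences x_k -> x with f(x_k) -> f(x) *)
Definition limiting_subdiff (R : realType) (n : nat) (f : 'rV[R]_n -> \bar R)
    (x : 'rV[R]_n) : set 'rV[R]_n :=
  [set v | f x \is a fin_num /\
     exists xs vs : nat -> 'rV[R]_n,
       [/\ xs k @[k --> \oo] --> x,
           f (xs k) @[k --> \oo] --> f x,
           vs k @[k --> \oo] --> v &
           forall k, regular_subdiff f (xs k) (vs k)]].

(* A set-valued operator A on R^n is a function to sets; y \in A x is A x y.   *)
Definition op_inv (T : Type) (A : T -> set T) : T -> set T :=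
  fun y => [set x | A x y].

Definition op_add (V : zmodType) (A B : V -> set V) : V -> set V :=
  fun x => [set y1 + y2 | y1 in A x & y2 in B x].

Definition parallel_sum (V : zmodType) (A B : V -> set V) : V -> set V :=
  op_inv (op_add (op_inv A) (op_inv B)).

Definition semimonotone (R : realType) (n : nat) (mu rho : R)
    (A : 'rV[R]_n -> set 'rV[R]_n) : Prop :=
  forall x y x' y', A x y -> A x' y' ->
    mu * enorm (x - x') ^+ 2 + rho * enorm (y - y') ^+ 2
      <= dot (x - x') (y - y').

(* Meaningful only if a = b = 0 or a + b != 0; if a = - b != 0 this is a junk  *)
(* value.                                                                      *)
Definition parallel_real (R : realType) (a b : R) : R :=
  if (a == 0) && (b == 0) then 0 else a * b / (a + b).

(* An infimum in the extended reals: for proper lsc functions it is a minimum  *)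
(* as soon as the sublevel sets {f1(w1) + f2(w2) <= r1, |w1 + w2 - s| <= r2}   *)
(* are bounded.                                                                *)
Definition inf_conv (R : realType) (n : nat) (f1 f2 : 'rV[R]_n -> \bar R) :
    'rV[R]_n -> \bar R :=
  fun s => ereal_inf [set (f1 w + f2 (s - w)%R)%E | w in [set: 'rV[R]_n]].

(* Main.v *)
Require Import Defs.
From HB Require Import structures.
From mathcomp Require Import all_boot all_order all_algebra.
From mathcomp Require Import all_classical all_reals all_analysis.
From mathcomp Require Import ring lra.
Import Order.TTheory GRing.Theory Num.Theory.
Import numFieldNormedType.Exports.

(** A subgradient of the infimal convolution [phi] at [s] is a subgradient of
    both functions at the two parts of an optimal splitting of [s].

    For regular subgradients this is immediate: if [phi (a + b) = f a + g b],
    then [z |-> f z + g b] lies above [z |-> phi (z + b)] and touches it at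
    [z = a], so every regular minorant of [phi] at [a + b] becomes one of [f] at
    [a] ([regular_subdiff_inf_conv]); exchanging the roles of [f] and [g] gives
    the other half.  A limiting subgradient [v] is a limit of regular ones [v_k]
    at points [s_k]; splitting each [s_k] optimally as [x_k + y_k], one has to
    pass to the limit in [x_k] and [y_k].  Level boundedness keeps them bounded,
    so a subsequence converges to some [a] and [b] with [a + b = s], and lower
    semicontinuity makes that limit splitting optimal too ([inf_conv_subcvg]).
    Because the sums [f x_k + g y_k] converge to [f a + g b] and neither
    function can drop below its value in the limit, neither can rise above it
    either, so each summand converges separately ([lsc_sum_cvgl]).  This is
    what the definition of the limiting subdifferential asks for, and it yields
    part (i) ([limiting_subdiff_inf_conv]).  The existence of optimal
    splittings comes from the same compactness argument, applied to minimising
    splittings of one fixed point ([inf_conv_attained]).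

    Part (ii) then concerns parallel sums of semimonotone operators only
    ([semimonotone_parallel]): adding the two semimonotonicity inequalities at
    a common output leaves
    [mu1 |u|^2 + mu2 |v|^2 >= (mu1 mu2 / (mu1 + mu2)) |u + v|^2],
    which multiplied by [mu1 + mu2 > 0] says that
    [|mu1 u - mu2 v|^2 >= 0] ([parallel_real_sqr_enorm]). *)

Set Implicit Arguments.
Unset Strict Implicit.

Local Open Scope classical_set_scope.
Local Open Scope ring_scope.

(** * Sequences in Euclidean space *)

(** Convergence is meant for the sup norm; this transfers it to the Euclidean
    norm in which the level sets are cut out. *)
Lemma cvg_enorm0 (R : realType) (n : nat) (u : nat -> 'rV[R]_n) :
  u k @[k --> \oo] --> (0 : 'rV[R]_n) -> enorm (u k) @[k --> \oo] --> (0 : R).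
Proof.
move=> u0.
have dot0 : dot (u k) (u k) @[k --> \oo] --> (0 : R).
  have -> : (0 : R) = \sum_(i < n) 0 by rewrite big1.
  rewrite /dot; apply: cvg_big; first exact: add_continuous.
  move=> i _; have ui : u k 0 i @[k --> \oo] --> (0 : R).
    have := @coord_continuous R 1 n 0 i 0; rewrite /continuous_at mxE => ci.
    exact: (cvg_comp _ _ u0 ci).
  by rewrite -[X in _ --> X](mulr0 0); exact: cvgM.
have := @sqrt_continuous R 0; rewrite /continuous_at sqrtr0 => sqrt0.
exact: (cvg_comp _ _ dot0 sqrt0).
Qed.

(** Bolzano-Weierstrass.  The extraction [f] need not be increasing: tending to
    infinity is enough for every convergent sequence to keep its limit
    along [f]. *)
Lemma bounded_seq_subcvg (R : realType) (n : nat) (M : R)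
    (x : nat -> 'rV[R]_n) :
  (\forall k \near \oo, `|x k| <= M) ->
  exists (f : nat -> nat) (a : 'rV[R]_n),
    f @ \oo --> \oo /\ x (f k) @[k --> \oo] --> a.
Proof.
move=> xM.
pose A := [set v : 'rV[R]_n | `|v| <= M].
have cA : compact A.
  apply: bounded_closed_compact.
    exists M; split; first exact: num_real.
    by move=> N MN v /= /le_trans; apply; exact: ltW.
  by apply: (preimage_closed _ (@closed_le _ M)) => y _; exact: norm_continuous.
have [a [_ acl]] := cA (x @ \oo) _ xM.
have near_a k : {m : nat | (k <= m)%N & ball a k.+1%:R^-1 (x m)}.
  apply: cid2.
  have tail : (x @ \oo) [set x m | m in [set m | (k <= m)%N]].
    by exists k => // m km; exists m.
  have [|_ [[m km <-] am]] := acl _ (ball a k.+1%:R^-1) tail.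
    by apply: nbhsx_ballx; rewrite invr_gt0.
  by exists m.
exists (fun k => s2val (near_a k)), a; split.
  move=> P [N _ NP]; exists N => // k Nk; apply: NP => /=.
  by apply: (leq_trans Nk); case: (near_a k).
apply/cvgrPdist_lt => e e0.
have := @cvg_harmonic R; move/cvgrPdist_lt => /(_ e e0).
apply: filterS => k; rewrite sub0r normrN /harmonic /= => ke.
case: (near_a k) => m km; rewrite -ball_normE /= => /lt_trans; apply.
by move: ke; rewrite ger0_norm.
Qed.

(** * Sums of lower semicontinuous functions along sequences *)

Section lsc_sum.
Local Open Scope ereal_scope.

Lemma lt_adde_split (R : realType) (l : R) (p q : \bar R) :
  p != -oo -> q != -oo -> l%:E < p + q ->
  exists a b : R, [/\ a%:E < p, b%:E < q & (l < a + b)%R].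
Proof.
move: p q => [p| |] [q| |] //= _ _.
(* Each summand gives up a third of the gap, so the sum stays above l. *)
- rewrite -EFinD lte_fin => lpq.
  exists (p - (p + q - l) / 3)%R, (q - (p + q - l) / 3)%R.
  by rewrite !lte_fin; split; lra.
- move=> _; exists (p - 1)%R, (l - p + 2)%R.
  by rewrite lte_fin ltry; split=> //; lra.
- move=> _; exists (l - q + 2)%R, (q - 1)%R.
  by rewrite lte_fin ltry; split=> //; lra.
- by move=> _; exists (l + 1)%R, 0%R; rewrite !ltry; split=> //; lra.
Qed.

Lemma lsc_near (R : realType) (T : topologicalType) (f : T -> \bar R)
    (x : nat -> T) (a : T) (c : R) :
  lower_semicontinuous f -> x k @[k --> \oo] --> a -> c%:E < f a ->
  \forall k \near \oo, c%:E < f (x k).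
Proof.
move=> flsc xa /flsc[V aV VP]; near=> k; apply: VP; near: k; exact: xa.
Unshelve. all: by end_near. Qed.

Lemma lsc_sum_le (R : realType) (T : topologicalType) (f1 f2 : T -> \bar R)
    (x y : nat -> T) (a b : T) (l : R) :
  lower_semicontinuous f1 -> lower_semicontinuous f2 ->
  f1 a != -oo -> f2 b != -oo ->
  x k @[k --> \oo] --> a -> y k @[k --> \oo] --> b ->
  f1 (x k) + f2 (y k) @[k --> \oo] --> l%:E ->
  f1 a + f2 b <= l%:E.
Proof.
move=> lsc1 lsc2 f1a f2b xa yb xyl; rewrite leNgt; apply/negP.
move=> /(lt_adde_split f1a f2b)[c [d [ca db lcd]]].
have : (c + d)%:E <= l%:E.
  apply: (cvge_to_ge xyl).
  have := lsc_near lsc2 yb db; have := lsc_near lsc1 xa ca.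
  by apply: filterS2 => k /ltW ck /ltW dk; rewrite EFinD leeD.
by rewrite lee_fin leNgt lcd.
Qed.

(** Lower semicontinuity bounds both summands from below by nearly their limit
    values.  Since the sum converges, an excess of the first summand would have
    to be compensated by a deficit of the second, which is thereby excluded. *)
Lemma lsc_sum_cvgl (R : realType) (T : topologicalType) (f1 f2 : T -> \bar R)
    (x y : nat -> T) (a b : T) :
  lower_semicontinuous f1 -> lower_semicontinuous f2 ->
  f1 a \is a fin_num -> f2 b \is a fin_num ->
  x k @[k --> \oo] --> a -> y k @[k --> \oo] --> b ->
  f1 (x k) + f2 (y k) @[k --> \oo] --> f1 a + f2 b ->
  f1 (x k) @[k --> \oo] --> f1 a.
Proof.
move=> lsc1 lsc2 + + xa yb.
case E1: (f1 a) => [p| |] // _; case E2: (f2 b) => [q| |] // _.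
move=> /fine_cvgP[finS /cvgrPdist_lt cvgS].
have near1 (e : R) : (0 < e)%R -> \forall k \near \oo, (p - e)%:E < f1 (x k).
  by move=> e0; apply: (lsc_near lsc1 xa); rewrite E1 lte_fin; lra.
have near2 (e : R) : (0 < e)%R -> \forall k \near \oo, (q - e)%:E < f2 (y k).
  by move=> e0; apply: (lsc_near lsc2 yb); rewrite E2 lte_fin; lra.
apply/fine_cvgP; split.
  move: finS (near1 1%R ltr01) (near2 1%R ltr01); apply: filterS3 => k.
  by case: (f1 (x k)) (f2 (y k)) => [?| |] [?| |].
apply/cvgrPdist_lt => e e0; have e20 : (0 < e / 2)%R by rewrite divr_gt0.
near=> k.
have : f1 (x k) + f2 (y k) \is a fin_num by near: k.
have : (`|p + q - fine (f1 (x k) + f2 (y k))| < e / 2)%R.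
  by near: k; exact: (cvgS _ e20).
have : (p - e)%:E < f1 (x k) by near: k; exact: near1.
have : (q - e / 2)%:E < f2 (y k) by near: k; exact: near2.
move=> + + + +; rewrite /=; case: (f1 (x k)) (f2 (y k)) => [u| |] [v| |] //=.
rewrite !lte_fin !ltr_norml => ? ? /andP[? ?] _; apply/andP; split; lra.
Unshelve. all: by end_near. Qed.

End lsc_sum.

(** * Regular subgradients of an infimal convolution *)

Section inf_conv.
Local Open Scope ereal_scope.
Context {R : realType} {n : nat}.
Implicit Types f g : 'rV[R]_n -> \bar R.

Lemma inf_conv_le f g (a b : 'rV[R]_n) : inf_conv f g (a + b)%R <= f a + g b.
Proof. by apply: ereal_inf_lbound; exists a => //; rewrite addrAC subrr add0r. Qed.

Lemma inf_convC f g : inf_conv f g = inf_conv g f.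
Proof.
apply/funext => s; congr ereal_inf; apply/seteqP; split=> _ [w _ <-];
  by exists (s - w)%R => //; rewrite subKr addeC.
Qed.

(** [z |-> f z + g b] lies above [z |-> inf_conv f g (z + b)], with equality at
    [a], so it inherits the first-order minorants of the latter at [a]. *)
Lemma regular_subdiff_inf_conv f g (a b v : 'rV[R]_n) :
  f a + g b = inf_conv f g (a + b)%R ->
  regular_subdiff (inf_conv f g) (a + b)%R v -> regular_subdiff f a v.
Proof.
set s := (a + b)%R; move=> fg [finS reg].
have [fa gb] : f a \is a fin_num /\ g b \is a fin_num.
  by move: finS; rewrite -fg fin_numD => /andP.
split=> // e e0.
have shift : (z + b)%R @[z --> a] --> s.
  exact: (cvgD cvg_id (cvg_cst b)).
near=> z; rewrite -(leeD2rE _ _ gb) addeAC fg.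
have -> : ((z - a)%R = (z + b - s)%R) by rewrite /s opprD addrACA subrr addr0.
apply: le_trans (inf_conv_le f g z b).
by near: z; exact: (shift _ (reg e e0)).
Unshelve. all: by end_near. Qed.

End inf_conv.

(** * Compactness of nearly optimal splittings *)

Section level_bounded.
Local Open Scope ereal_scope.
Context {R : realType} {n : nat} (f g : 'rV[R]_n -> \bar R).
Hypotheses (fNy : forall x, f x != -oo) (gNy : forall x, g x != -oo).
Hypotheses (flsc : lower_semicontinuous f) (glsc : lower_semicontinuous g).
Hypothesis level_bounded : forall (r1 : R) (sbar : 'rV[R]_n), (0 <= r1)%R ->
  exists r2 : R, (0 < r2)%R /\
    bounded_set [set w : 'rV[R]_n * 'rV[R]_n |
      f w.1 + g w.2 <= r1%:E /\ (enorm (w.1 + w.2 - sbar) <= r2)%R].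

(** Asymptotically optimal splittings cluster at an optimal splitting.  It is
    used twice: with [x k + y k] constant to get optimal splittings, and with
    [x k + y k] moving to pass to the limit in regular subgradients. *)
Lemma inf_conv_subcvg (s : 'rV[R]_n) (x y : nat -> 'rV[R]_n) :
  inf_conv f g s \is a fin_num ->
  (x k + y k)%R @[k --> \oo] --> s ->
  f (x k) + g (y k) @[k --> \oo] --> inf_conv f g s ->
  exists (h : nat -> nat) (a b : 'rV[R]_n),
    [/\ h @ \oo --> \oo, x (h k) @[k --> \oo] --> a,
        y (h k) @[k --> \oo] --> b, (a + b)%R = s &
        f a + g b = inf_conv f g s].
Proof.
case E: (inf_conv f g s) => [l| |] // _ xys xyl.
(* |l| + 1 is a nonnegative level above l: the pairs are eventually below it. *)
have r0 : (0 <= `|l| + 1 :> R)%R by rewrite addr_ge0.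
have [r2 [r20 [M [_ MP]]]] := level_bounded s r0.
have xM : \forall k \near \oo, (`|x k| <= M + 1)%R.
  have MM : (M < M + 1)%R by rewrite ltrDl.
  near=> k; have /= H := MP _ MM (x k, y k).
  apply: (@le_trans _ _ `|(x k, y k)|%R); first by rewrite prod_normE /= le_max lexx.
  apply: H; split; last first.
    apply: ltW; near: k.
    have /cvg_enorm0/cvgrPdist_lt/(_ _ r20) :
        (x k + y k - s)%R @[k --> \oo] --> (0 : 'rV[R]_n)%R.
      by apply/subr_cvg0.
    by apply: filterS => k; rewrite sub0r normrN => /(le_lt_trans (ler_norm _)).
  near: k; move/fine_cvgP: xyl => [fin /cvgrPdist_lt/(_ 1%R ltr01)].
  move: fin; apply: filterS2 => k /=.
  case: (_ + _) => [u| |] //= _; rewrite lee_fin => lu.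
  by have := ler_norm l; move: lu; rewrite ltr_norml => /andP[]; lra.
have [h [a [hoo xa]]] := bounded_seq_subcvg xM.
have yb : y (h k) @[k --> \oo] --> (s - a)%R.
  have -> : (fun k => y (h k)) = (fun k => (x (h k) + y (h k)) - x (h k))%R.
    by apply/funext => k; rewrite addrAC subrr add0r.
  by apply: cvgB => //; exact: (cvg_comp _ _ hoo xys).
have ab : (a + (s - a) = s)%R by rewrite addrC subrK.
exists h, a, (s - a)%R; split=> //.
apply/eqP; rewrite eq_le; apply/andP; split.
  apply: (lsc_sum_le flsc glsc (fNy a) (gNy _) xa yb).
  exact: (cvg_comp _ _ hoo xyl).
by rewrite -E -{1}ab inf_conv_le.
Unshelve. all: by end_near. Qed.

Lemma inf_conv_attained (s : 'rV[R]_n) : inf_conv f g s \is a fin_num ->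
  exists a b : 'rV[R]_n, (a + b)%R = s /\ f a + g b = inf_conv f g s.
Proof.
move=> fins.
have approx k : {w : 'rV[R]_n |
    f w + g (s - w)%R < inf_conv f g s + (k.+1%:R^-1)%:E}.
  apply: cid; have k0 : (0 < k.+1%:R^-1 :> R)%R by rewrite invr_gt0.
  by have [_ [w _ <-] ws] := lb_ereal_inf_adherent k0 fins; exists w.
pose x k := sval (approx k).
have xs : (x k + (s - x k))%R @[k --> \oo] --> s.
  by under eq_fun do rewrite addrC subrK; exact: cvg_cst.
have xl : f (x k) + g (s - x k)%R @[k --> \oo] --> inf_conv f g s.
  apply: (@squeeze_cvge _ _ _ _ (cst (inf_conv f g s)) _
    (fun k => inf_conv f g s + (k.+1%:R^-1)%:E)); last 2 first.
  - exact: cvg_cst.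
  - rewrite -[X in _ --> X]adde0; apply: cvgeD; first exact: fin_num_adde_defr.
      exact: cvg_cst.
    by apply: cvg_EFin; [exact: nearW|exact: cvg_harmonic].
  apply: nearW => k; rewrite (ltW (svalP (approx k))) andbT /=.
  by have := inf_conv_le f g (x k) (s - x k)%R; rewrite addrC subrK.
have [h [a [b [_ _ _ ab abE]]]] := inf_conv_subcvg fins xs xl.
by exists a, b.
Qed.

Lemma limiting_subdiff_inf_conv (s v : 'rV[R]_n) :
  limiting_subdiff (inf_conv f g) s v ->
  exists a b : 'rV[R]_n,
    [/\ (a + b)%R = s, limiting_subdiff f a v & limiting_subdiff g b v].
Proof.
move=> [fins [xs [vs [xss xsl vsv reg]]]].
have split_xs k : {w : 'rV[R]_n * 'rV[R]_n | (w.1 + w.2)%R = xs k /\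
    f w.1 + g w.2 = inf_conv f g (xs k)}.
  apply: cid; have [a [b abE]] := inf_conv_attained (proj1 (reg k)).
  by exists (a, b).
pose x k := (sval (split_xs k)).1; pose y k := (sval (split_xs k)).2.
have xyE k : (x k + y k)%R = xs k by rewrite /x /y; case: (split_xs k) => ? [].
have fgE k : f (x k) + g (y k) = inf_conv f g (xs k).
  by rewrite /x /y; case: (split_xs k) => ? [].
have regf k : regular_subdiff f (x k) (vs k).
  by apply: (@regular_subdiff_inf_conv _ _ f g _ (y k)); rewrite xyE.
have regg k : regular_subdiff g (y k) (vs k).
  have yxE : (y k + x k)%R = xs k by rewrite -(xyE k) addrC.
  apply: (@regular_subdiff_inf_conv _ _ g f _ (x k)); rewrite yxE inf_convC.
    by rewrite addeC fgE.
  exact: reg.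
have [| |h [a [b [hoo xa yb ab abE]]]] := @inf_conv_subcvg s x y fins.
- by under eq_fun do rewrite xyE.
- by under eq_fun do rewrite fgE.
have [fa gb] : f a \is a fin_num /\ g b \is a fin_num.
  by move: fins; rewrite -abE fin_numD => /andP.
have sub_cvg (U : topologicalType) (u : nat -> U) (c : U) :
    u @ \oo --> c -> u (h k) @[k --> \oo] --> c.
  exact: cvg_comp.
have fgab : f (x (h k)) + g (y (h k)) @[k --> \oo] --> f a + g b.
  by under eq_fun do rewrite fgE; rewrite abE; exact: sub_cvg xsl.
have vsh : vs (h k) @[k --> \oo] --> v by exact: (sub_cvg _ vs v vsv).
have gfab : g (y (h k)) + f (x (h k)) @[k --> \oo] --> g b + f a.
  by under eq_fun do rewrite addeC; rewrite addeC.
have fxa := lsc_sum_cvgl flsc glsc fa gb xa yb fgab.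
have gyb := lsc_sum_cvgl glsc flsc gb fa yb xa gfab.
exists a, b; split=> //; split=> //.
- exists (fun k => x (h k)), (fun k => vs (h k)); split.
  + exact: xa.
  + exact: fxa.
  + exact: vsh.
  + by move=> k; exact: regf.
- exists (fun k => y (h k)), (fun k => vs (h k)); split.
  + exact: yb.
  + exact: gyb.
  + exact: vsh.
  + by move=> k; exact: regg.
Qed.

End level_bounded.

(** * Semimonotonicity of parallel sums *)

Section dot.
Context {R : realType} {n : nat}.
Implicit Types u v w : 'rV[R]_n.

Lemma dotDl u v w : dot (u + v) w = dot u w + dot v w.
Proof. by rewrite /dot -big_split; apply: eq_bigr => i _; rewrite mxE mulrDl. Qed.

Lemma sqr_enorm u : enorm u ^+ 2 = \sum_(i < n) u 0 i ^+ 2.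
Proof.
have E : dot u u = \sum_(i < n) u 0 i ^+ 2.
  by apply: eq_bigr => i _; rewrite expr2.
by rewrite /enorm sqr_sqrtr E // sumr_ge0 // => i _; exact: sqr_ge0.
Qed.

(** Multiplied by [mu1 + mu2], the difference of the two sides is
    [|mu1 u - mu2 v|^2]; the computation is done coordinatewise. *)
Lemma parallel_real_sqr_enorm (mu1 mu2 : R) u v :
  0 < mu1 + mu2 \/ (mu1 = 0 /\ mu2 = 0) ->
  parallel_real mu1 mu2 * enorm (u + v) ^+ 2 <=
    mu1 * enorm u ^+ 2 + mu2 * enorm v ^+ 2.
Proof.
rewrite /parallel_real => -[mu_gt0|[-> ->]]; last by rewrite eqxx !mul0r addr0.
case: ifP => [/andP[/eqP m1 /eqP m2]|_]; first by rewrite m1 m2 addr0 ltxx in mu_gt0.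
rewrite !sqr_enorm !mulr_sumr -big_split /=; apply: ler_sum => i _.
rewrite mxE mulrAC ler_pdivrMr // -subr_ge0.
rewrite [leRHS](_ : _ = (mu1 * u 0 i - mu2 * v 0 i) ^+ 2); last by ring.
exact: sqr_ge0.
Qed.

End dot.

(** Points of the graph of the parallel sum split as [a + b] with one common
    output [y], so that the two defining inequalities add up: the [rho] terms
    share the factor [|y - y'|^2]. *)
Lemma semimonotone_parallel (R : realType) (n : nat) (mu1 rho1 mu2 rho2 : R)
    (A B : 'rV[R]_n -> set 'rV[R]_n) :
  0 < mu1 + mu2 \/ (mu1 = 0 /\ mu2 = 0) ->
  semimonotone mu1 rho1 A -> semimonotone mu2 rho2 B ->
  semimonotone (parallel_real mu1 mu2) (rho1 + rho2) (parallel_sum A B).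
Proof.
move=> mu_cond semA semB s y s' y' [a Aa [b Bb <-]] [a' Aa' [b' Bb' <-]].
have -> : a + b - (a' + b') = (a - a') + (b - b') by rewrite opprD addrACA.
rewrite dotDl; apply: le_trans (lerD (semA _ _ _ _ Aa Aa') (semB _ _ _ _ Bb Bb')).
by rewrite [leRHS]addrACA -mulrDl lerD2r; exact: parallel_real_sqr_enorm.
Qed.

Unset Implicit Arguments.
Set Strict Implicit.

Theorem proposition4p16 (R : realType) (n : nat)
    (f1 f2 : 'rV[R]_n -> \bar R) (mu1 rho1 mu2 rho2 : R)
    (f1_proper : proper_efun f1) (f1_lsc : lower_semicontinuous f1)
    (f2_proper : proper_efun f2) (f2_lsc : lower_semicontinuous f2)
    (f1_semi : semimonotone mu1 rho1 (limiting_subdiff f1))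
    (f2_semi : semimonotone mu2 rho2 (limiting_subdiff f2))
    (mu_cond : 0 < mu1 + mu2 \/ (mu1 = 0 /\ mu2 = 0))
    (level_bounded : forall (r1 : R) (sbar : 'rV[R]_n), 0 <= r1 ->
       exists r2 : R, 0 < r2 /\
         bounded_set [set w : 'rV[R]_n * 'rV[R]_n |
           (f1 w.1 + f2 w.2 <= r1%:E)%E /\ enorm (w.1 + w.2 - sbar) <= r2]) :
  (forall sbar : 'rV[R]_n,
     limiting_subdiff (inf_conv f1 f2) sbar `<=`
     parallel_sum (limiting_subdiff f1) (limiting_subdiff f2) sbar) /\
  semimonotone (parallel_real mu1 mu2) (rho1 + rho2)
    (limiting_subdiff (inf_conv f1 f2)).
Proof.
have sub_par (s : 'rV[R]_n) : limiting_subdiff (inf_conv f1 f2) s `<=`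
    parallel_sum (limiting_subdiff f1) (limiting_subdiff f2) s.
  move=> v /(limiting_subdiff_inf_conv f1_proper.1 f2_proper.1 f1_lsc f2_lsc
    level_bounded)[a [b [<- fa gb]]].
  by exists a => //; exists b.
split=> // s y s' y' /sub_par sy /sub_par sy'.
exact: (semimonotone_parallel mu_cond f1_semi f2_semi).
Qed.
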